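(* Let $A$ be a GCD domain and $M$ a torsion-free $A$-module. Then $M$ is a PS module over $A$ if and only if $M_P$ is a PS module over $A_P$ for each maximal ideal $P$ of $A$.
   Context: All rings are commutative and unitary. For an integral domain $A$, a torsion-free $A$-module $M$ is a PS module (pre-Schreier module) if every equality $ax=by$ with $a,b\in A-\{0\}$ and $x,y\in M-\{0\}$ has a refinement, i.e. there exist $c,d,e\in A$ and $z\in M$ with $a=ce$, $b=cd$, $x=dz$, $y=ez$. A GCD domain is a domain in which any two nonzero elements have a greatest common divisor. *)

(* Defs.v *)
From HB Require Import structures.
From mathcomp Require Import all_boot all_order all_algebra ring.
From mathcomp Require Import boolp.

Set Implicit Arguments.
Unset Strict Implicit.
Unset Printing Implicit Defensive.

Import GRing.Theory.
Local Open Scope ring_scope.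
Local Open Scope quotient_scope.

Definition divides (A : idomainType) (d a : A) : Prop := exists c, a = c * d.

Definition is_gcd (A : idomainType) (a b d : A) : Prop :=
  [/\ divides d a, divides d b
    & forall e, divides e a -> divides e b -> divides e d].

Definition GCD_domain (A : idomainType) : Prop :=
  forall a b : A, a != 0 -> b != 0 -> exists d, is_gcd a b d.

Definition torsion_free (A : idomainType) (M : lmodType A) : Prop :=
  forall (a : A) (x : M), a *: x = 0 -> a = 0 \/ x = 0.

Definition PS_module (A : idomainType) (M : lmodType A) : Prop :=
  torsion_free M /\
  forall (a b : A) (x y : M), a != 0 -> b != 0 -> x != 0 -> y != 0 ->
    a *: x = b *: y ->
    exists (c d e : A) (z : M),
      [/\ a = c * e, b = c * d, x = d *: z & y = e *: z].

(* [idealr_closed] includes properness (1 \notin P), so this is maximality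
   among proper ideals. *)
Definition maximal_ideal (A : idomainType) (P : {pred A}) : Prop :=
  idealr_closed P /\
  forall J : {pred A}, idealr_closed J -> {subset P <= J} -> J =i P.

Lemma maximal_ideal_prime (A : idomainType) (P : {pred A}) :
  maximal_ideal P -> prime_idealr_closed P.
Proof.
move=> [[P0 P1 PI] maxP] u v uvP.
case: (boolP (u \in P)) => //= uNP.
have PM a p : p \in P -> a * p \in P by move=> pP; rewrite -[a * p]addr0 PI.
have PD p q : p \in P -> q \in P -> p + q \in P.
  by move=> pP qP; rewrite -[p]mul1r PI.
pose J : {pred A} := [pred x | `[< exists p a, p \in P /\ x = p + a * u >]].
have PJ : {subset P <= J}.
  by move=> x xP; apply/asboolP; exists x, 0; rewrite mul0r addr0.
have uJ : u \in J by apply/asboolP; exists 0, 1; rewrite mul1r add0r.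
have [/asboolP[p [a [pP E]]]|J1] := boolP (1 \in J).
  rewrite -[v]mul1r E mulrDl; apply: PD; first by rewrite mulrC PM.
  by rewrite -mulrA PM.
have JI : idealr_closed J.
  split=> [||a x y /asboolP[p [b [pP ->]]] /asboolP[q [c [qP ->]]]] //.
    exact: PJ.
  apply/asboolP; exists (a * p + q), (a * b + c); split; first exact: PI.
  by ring.
by rewrite -(maxP J JI PJ) uJ in uNP.
Qed.

Definition prime_of_maximal (A : idomainType) (P : {pred A})
    (mP : maximal_ideal P) : prime_idealr A :=
  HB.pack_for (prime_idealr A) (P : A -> bool)
    (isIdealr.Build A P mP.1)
    (isPrimeIdealrClosed.Build A P (maximal_ideal_prime mP)).

(* Localization at a prime ideal P: [localization P M] is M_P, the quotient of
   M * (A \ P) by (x, s) ~ (y, t) iff u t x = u s y for some u \notin P, and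
   [local_ring P] is A_P, obtained from the regular module A^o. *)
Section Localization.
Variables (A : idomainType) (P : prime_idealr A).

Record denom := Denom { dval : A; denomP : dval \notin P }.
HB.instance Definition _ := [isSub for dval].
HB.instance Definition _ := [Choice of denom by <:].

Lemma denom_subproof1 : (1 : A) \notin P.
Proof. by rewrite idealr1. Qed.

Lemma denom_subproofM (s t : denom) : dval s * dval t \notin P.
Proof. by rewrite prime_idealrM negb_or (denomP s) (denomP t). Qed.

Definition denom1 : denom := Denom denom_subproof1.
Definition denomM (s t : denom) : denom := Denom (denom_subproofM s t).

Section Carrier.
Variable M : lmodType A.
Implicit Types (x y z : M) (s t : denom) (m n : M * denom).

Definition loc_equiv m n : bool :=
  `[< exists u : denom,
        dval u *: (dval n.2 *: m.1) = dval u *: (dval m.2 *: n.1) >].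

Lemma loc_equiv_refl : reflexive loc_equiv.
Proof. by move=> m; apply/asboolP; exists denom1. Qed.

Lemma loc_equiv_sym : symmetric loc_equiv.
Proof.
by move=> m n; apply/asboolP/asboolP => -[u E]; exists u; rewrite E.
Qed.

Lemma loc_equiv_trans : transitive loc_equiv.
Proof.
move=> [y t] [x s] [z r] /asboolP[u /= E1] /asboolP[v /= E2]; apply/asboolP.
exists (denomM (denomM u v) t) => /=; rewrite !scalerA in E1 E2 *.
transitivity ((dval v * dval r) *: ((dval u * dval t) *: x)).
  by rewrite !scalerA; congr (_ *: _); ring.
rewrite E1 scalerA.
transitivity ((dval u * dval s) *: ((dval v * dval r) *: y)).
  by rewrite !scalerA; congr (_ *: _); ring.
by rewrite E2 scalerA; congr (_ *: _); ring.
Qed.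

Canonical loc_equiv_equiv :=
  EquivRel loc_equiv loc_equiv_refl loc_equiv_sym loc_equiv_trans.

Definition localization : Type := {eq_quot loc_equiv}.
HB.instance Definition _ : EqQuotient _ loc_equiv localization :=
  EqQuotient.on localization.
HB.instance Definition _ := Choice.on localization.

(* the fraction x / s *)
Definition loc_frac x s : localization := \pi_localization (x, s).

Lemma loc_fracP (q : localization) : exists x s, q = loc_frac x s.
Proof.
by exists (repr q).1, (repr q).2; rewrite /loc_frac -surjective_pairing reprK.
Qed.

Lemma loc_frac_eq x s y t :
  loc_frac x s = loc_frac y t <->
  exists u : denom, dval u *: (dval t *: x) = dval u *: (dval s *: y).
Proof. by split=> [/eqmodP/asboolP//|E]; apply/eqmodP/asboolP. Qed.

Lemma loc_frac_reprE x s :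
  exists u : denom, dval u *: (dval (repr (loc_frac x s)).2 *: x) =
                    dval u *: (dval s *: (repr (loc_frac x s)).1).
Proof.
by apply/loc_frac_eq; rewrite {2}/loc_frac -surjective_pairing reprK.
Qed.

Definition loc_zero : localization := loc_frac 0 denom1.
Definition loc_add (p q : localization) : localization :=
  let: (x, s) := repr p in let: (y, t) := repr q in
  loc_frac (dval t *: x + dval s *: y) (denomM s t).
Definition loc_opp (p : localization) : localization :=
  let: (x, s) := repr p in loc_frac (- x) s.

Lemma loc_addE x s y t :
  loc_add (loc_frac x s) (loc_frac y t) =
  loc_frac (dval t *: x + dval s *: y) (denomM s t).
Proof.
rewrite /loc_add; case: (loc_frac_reprE x s) (loc_frac_reprE y t).
case: (repr (loc_frac x s)) => x' s'; case: (repr (loc_frac y t)) => y' t' /=.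
move=> u Eu [v Ev]; apply/loc_frac_eq; exists (denomM u v) => /=.
rewrite !scalerDr !scalerA in Eu Ev *; congr (_ + _).
  transitivity ((dval v * dval t' * dval t) *: ((dval u * dval s) *: x')).
    by rewrite !scalerA; congr (_ *: _); ring.
  by rewrite -Eu !scalerA; congr (_ *: _); ring.
transitivity ((dval u * dval s' * dval s) *: ((dval v * dval t) *: y')).
  by rewrite !scalerA; congr (_ *: _); ring.
by rewrite -Ev !scalerA; congr (_ *: _); ring.
Qed.

Lemma loc_oppE x s : loc_opp (loc_frac x s) = loc_frac (- x) s.
Proof.
rewrite /loc_opp; case: (loc_frac_reprE x s); case: (repr _) => x' s' u /= E.
by apply/loc_frac_eq; exists u; rewrite !scalerN E.
Qed.

Lemma loc_addA : associative loc_add.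
Proof.
move=> p q r; have [x [s ->]] := loc_fracP p; have [y [t ->]] := loc_fracP q.
have [z [w ->]] := loc_fracP r; rewrite !loc_addE; apply/loc_frac_eq.
exists denom1 => /=; rewrite !scalerDr !scalerA -!addrA.
by congr (_ *: _ + (_ *: _ + _ *: _)); ring.
Qed.

Lemma loc_addC : commutative loc_add.
Proof.
move=> p q; have [x [s ->]] := loc_fracP p; have [y [t ->]] := loc_fracP q.
rewrite !loc_addE; apply/loc_frac_eq; exists denom1 => /=.
by rewrite addrC (mulrC (dval t)).
Qed.

Lemma loc_add0 : left_id loc_zero loc_add.
Proof.
move=> p; have [x [s ->]] := loc_fracP p; rewrite loc_addE.
apply/loc_frac_eq; exists denom1 => /=.
by rewrite scaler0 add0r !scale1r mul1r.
Qed.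

Lemma loc_addN : left_inverse loc_zero loc_opp loc_add.
Proof.
move=> p; have [x [s ->]] := loc_fracP p; rewrite loc_oppE loc_addE.
by apply/loc_frac_eq; exists denom1 => /=; rewrite scalerN addNr !scaler0.
Qed.

HB.instance Definition _ :=
  GRing.isZmodule.Build localization loc_addA loc_addC loc_add0 loc_addN.

Lemma loc_fracD x s y t :
  loc_frac x s + loc_frac y t =
  loc_frac (dval t *: x + dval s *: y) (denomM s t).
Proof. exact: loc_addE. Qed.

End Carrier.

Definition local_ring : Type := localization A^o.
HB.instance Definition _ := GRing.Zmodule.on local_ring.

Definition loc_ring_frac (a : A) (s : denom) : local_ring :=
  loc_frac (a : A^o) s.

Lemma loc_ring_fracP (p : local_ring) :
  exists (a : A) (s : denom), p = loc_ring_frac a s.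
Proof. exact: (@loc_fracP A^o p). Qed.

Section Scale.
Variable M : lmodType A.

Definition loc_scale (p : local_ring) (q : localization M) : localization M :=
  let: (a, s) := repr p in let: (x, t) := repr q in
  loc_frac ((a : A) *: x) (denomM s t).

Lemma loc_scaleE (a : A) s (x : M) t :
  loc_scale (loc_ring_frac a s) (loc_frac x t) =
  loc_frac (a *: x) (denomM s t).
Proof.
rewrite /loc_scale /loc_ring_frac.
case: (loc_frac_reprE (a : A^o) s) (loc_frac_reprE x t).
case: (repr _) => a' s'; case: (repr _) => x' t' /= u Eu [v Ev].
apply/loc_frac_eq; exists (denomM u v) => /=; rewrite !scalerA in Ev *.
have {}Eu : dval u * (dval s' * a) = dval u * (dval s * a') by exact: Eu.
transitivity ((dval u * (dval s * a')) *: ((dval v * dval t) *: x')).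
  by rewrite !scalerA; congr (_ *: _); ring.
by rewrite -Ev -Eu !scalerA; congr (_ *: _); ring.
Qed.

Lemma loc_scaleDr : right_distributive loc_scale +%R.
Proof.
move=> p q r; have [a [s ->]] := loc_fracP p; have [x [t ->]] := loc_fracP q.
have [y [w ->]] := loc_fracP r; rewrite -/(loc_ring_frac a s).
rewrite !(loc_fracD, loc_scaleE); apply/loc_frac_eq; exists denom1 => /=.
by rewrite !scalerDr !scalerA; congr (_ *: _ + _ *: _); ring.
Qed.

Lemma loc_scaleDl q : {morph loc_scale^~ q : p r / p + r}.
Proof.
move=> p r; have [a [s ->]] := loc_fracP p; have [b [t ->]] := loc_fracP r.
have [x [w ->]] := loc_fracP q.
have -> : (loc_frac a s : local_ring) + loc_frac b t =
    loc_ring_frac (dval t * a + dval s * b) (denomM s t) by exact: loc_addE.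
rewrite -/(loc_ring_frac a s) -/(loc_ring_frac b t).
rewrite !(loc_fracD, loc_scaleE); apply/loc_frac_eq; exists denom1 => /=.
by rewrite scalerDl !scalerDr !scalerA; congr (_ *: _ + _ *: _); ring.
Qed.

Lemma loc_scale1 : left_id (loc_ring_frac 1 denom1) loc_scale.
Proof.
move=> q; have [x [t ->]] := loc_fracP q; rewrite loc_scaleE scale1r.
by apply/loc_frac_eq; exists denom1 => /=; rewrite mul1r.
Qed.

End Scale.

Definition loc_mul : local_ring -> local_ring -> local_ring :=
  @loc_scale A^o.

Lemma loc_mulE (a b : A) s t :
  loc_mul (loc_ring_frac a s) (loc_ring_frac b t) =
  loc_ring_frac (a * b) (denomM s t).
Proof. exact: loc_scaleE. Qed.

Lemma loc_scaleA (M : lmodType A) p q (x : localization M) :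
  loc_scale p (loc_scale q x) = loc_scale (loc_mul p q) x.
Proof.
have [a [s ->]] := loc_fracP p; have [b [t ->]] := loc_fracP q.
have [y [w ->]] := loc_fracP x.
rewrite -/(loc_ring_frac a s) -/(loc_ring_frac b t) loc_mulE !loc_scaleE.
by apply/loc_frac_eq; exists denom1 => /=; rewrite !scalerA !mulrA.
Qed.

Lemma loc_mulA : associative loc_mul.
Proof. by move=> p q r; apply: loc_scaleA. Qed.

Lemma loc_mulC : commutative loc_mul.
Proof.
move=> p q; have [a [s ->]] := loc_fracP p; have [b [t ->]] := loc_fracP q.
rewrite -/(loc_ring_frac a s) -/(loc_ring_frac b t) !loc_mulE.
by apply/loc_frac_eq; exists denom1; rewrite /= (mulrC a) (mulrC (dval s)).
Qed.

Lemma loc_mul1 : left_id (loc_ring_frac 1 denom1) loc_mul.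
Proof. exact: loc_scale1. Qed.

Lemma loc_mulDl : left_distributive loc_mul +%R.
Proof. by move=> p q r; apply: loc_scaleDl. Qed.

Lemma loc_ring_frac_eq (a b : A) s t :
  loc_ring_frac a s = loc_ring_frac b t <-> dval t * a = dval s * b.
Proof.
split=> [/loc_frac_eq[u E]|E]; last first.
  by apply/loc_frac_eq; exists denom1; congr (_ *: _).
have u0 : dval u != 0 by apply: contraNneq (denomP u) => ->; rewrite idealr0.
exact: (mulfI u0).
Qed.

Lemma loc_one_neq0 : loc_ring_frac 1 denom1 != 0.
Proof.
apply/eqP => /loc_ring_frac_eq /=; rewrite mulr0 mulr1 => /eqP.
by rewrite oner_eq0.
Qed.

HB.instance Definition _ := GRing.Zmodule_isComNzRing.Build local_ring
  loc_mulA loc_mulC loc_mul1 loc_mulDl loc_one_neq0.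

Lemma loc_ring_fracM (a b : A) s t :
  loc_ring_frac a s * loc_ring_frac b t = loc_ring_frac (a * b) (denomM s t).
Proof. exact: loc_mulE. Qed.

Definition loc_unit : {pred local_ring} :=
  [pred p | `[< exists q, q * p = 1 >]].

Definition loc_inv (p : local_ring) : local_ring :=
  if pselect (exists q, q * p = 1) is left pU then projT1 (cid pU) else p.

Lemma loc_mulV : {in loc_unit, left_inverse 1 loc_inv *%R}.
Proof.
move=> p /asboolP pU; rewrite /loc_inv; case: pselect => // pU'.
exact: (projT2 (cid pU')).
Qed.

Lemma loc_unitP p q : q * p = 1 -> loc_unit p.
Proof. by move=> E; apply/asboolP; exists q. Qed.

Lemma loc_inv_out : {in [predC loc_unit], loc_inv =1 id}.
Proof.
by move=> p /asboolPn pU; rewrite /loc_inv; case: pselect.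
Qed.

HB.instance Definition _ := GRing.ComNzRing_hasMulInverse.Build local_ring
  loc_mulV loc_unitP loc_inv_out.

Lemma loc_integral : GRing.integral_domain_axiom local_ring.
Proof.
move=> p q; have [a [s ->]] := loc_fracP p; have [b [t ->]] := loc_fracP q.
rewrite -/(loc_ring_frac a s) -/(loc_ring_frac b t) loc_ring_fracM.
move=> /loc_ring_frac_eq /=; rewrite mul1r mulr0 => /eqP.
rewrite mulf_eq0 => /orP[] /eqP->; apply/orP; [left | right];
  by apply/eqP/loc_ring_frac_eq; rewrite !mulr0.
Qed.

HB.instance Definition _ :=
  GRing.ComUnitRing_isIntegral.Build local_ring loc_integral.

HB.instance Definition _ (M : lmodType A) :=
  GRing.Zmodule_isLmodule.Build local_ring (localization M)
    (@loc_scaleA M) (@loc_scale1 M) (@loc_scaleDr M) (@loc_scaleDl M).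

Lemma loc_fracZ (M : lmodType A) (a : A) s (x : M) t :
  loc_ring_frac a s *: loc_frac x t = loc_frac (a *: x) (denomM s t).
Proof. exact: loc_scaleE. Qed.

End Localization.

(* Main.v *)
Require Import Defs.
From mathcomp Require Import all_boot all_order all_algebra.
From mathcomp Require Import ring boolp classical_sets.

Import GRing.Theory.
Local Open Scope ring_scope.

(* Refinements pass to M_P by clearing denominators.  Conversely, cancelling
   gcd(a, b) reduces a x = b y to e x = d y with e and d coprime; it suffices to
   find x in d M.  A refinement of e x = d y in M_P has a common factor
   C = c / s, and c divides both w e and w d for some w outside P, hence divides
   w, so c is outside P: this produces r outside P with r x in d M.  Therefore
   the ideal {r | r x in d M} lies in no maximal ideal. *)

Section MaximalIdeals.
Local Open Scope classical_set_scope.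

(** Krull's theorem, from Zorn's lemma on sets ordered by inclusion. *)
Lemma maximal_ideal_exists (A : idomainType) (I : {pred A}) :
  idealr_closed I -> exists2 P : {pred A}, maximal_ideal P & {subset I <= P}.
Proof.
move=> [I0 I1 II].
(* Adjoining I lets the empty chain have an admissible union. *)
pose Q (X : set A) := [set x | X x \/ x \in I].
pose ideal_set (Y : set A) :=
  [/\ Y 0, ~ Y 1 & forall a u v, Y u -> Y v -> Y (a * u + v)].
have [F FI Ftot|X [[X0 X1 XI] Xmax]] :=
    @Zorn_bigcup A [set X | ideal_set (Q X)].
  split; first by right.
    by case=> [[X FX X1]|]; [case: (FI _ FX) => _ []; left | apply/negP].
  (* Two elements coming from chain members both lie in the larger member; elements of [I] are
     adjoined to every member. *)
  have QF Y u : F Y -> Q Y u -> Q (\bigcup_(X in F) X) u.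
    by move=> FY [Yu|]; [left; exists Y | right].
  move=> a u v [[X FX Xu]|Iu] [[Y FY Yv]|Iv].
  - case: (Ftot _ _ FX FY) => XY.
      by apply: (QF Y) => //; case: (FI _ FY) => _ _; apply; left; [apply: XY|].
    by apply: (QF X) => //; case: (FI _ FX) => _ _; apply; left; [|apply: XY].
  - by apply: (QF X) => //; case: (FI _ FX) => _ _; apply; [left | right].
  - by apply: (QF Y) => //; case: (FI _ FY) => _ _; apply; [right | left].
  - by right; apply: II.
pose P : {pred A} := [pred x | `[< Q X x >]].
have PE x : (x \in P) <-> Q X x by split=> /asboolP.
exists P; last by move=> x Ix; apply/PE; right.
split.
  split; [exact/PE | by apply/negP => /PE |].
  by move=> a u v /PE Qu /PE Qv; apply/PE/XI.
move=> J [J0 J1 JI] PJ x; apply/idP/idP; last exact: PJ.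
move=> Jx; apply: contrapT => NPx.
(* Adjoining [I] to [J] changes nothing, so [J] is admissible for Zorn. It strictly contains [X],
   since [x] is in [J] but not in [P], against maximality. *)
pose Y : set A := [set y | y \in J].
have QY y : Q Y y -> y \in J by case=> // Iy; apply/PJ/PE; right.
apply: (Xmax Y).
  split; first by move=> y Xy; apply/PJ/PE; left.
  by move=> YX; apply/NPx/PE; left; apply: YX.
split; first by left.
  by move=> /QY; apply/negP.
by move=> a u v /QY Ju /QY Jv; left; apply: JI.
Qed.

End MaximalIdeals.

(** A gcd [g] of [w * e] and [w * d] has the form [h * w]. Cancelling [w], [h] divides [e] and [d],
    hence 1, so [g] divides [w]; and [c] divides [g]. *)
Lemma gcd1_dvd_mul {A : idomainType} (c d e w : A) :
  GCD_domain A -> d != 0 -> e != 0 -> w != 0 -> is_gcd e d 1 ->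
  divides c (w * e) -> divides c (w * d) -> divides c w.
Proof.
move=> gcdA d0 e0 w0 [_ _ ed1] cwe cwd.
have [||g [gwe gwd gmax]] := gcdA (w * e) (w * d); rewrite ?mulf_neq0 //.
have [h gE] : divides w g by apply: gmax; [exists e | exists d]; rewrite mulrC.
have hdvd u : divides g (w * u) -> divides h u.
  move=> [k E]; exists k; apply: (mulfI w0); rewrite E gE; ring.
have [k k1] := ed1 h (hdvd e gwe) (hdvd d gwd).
have [l gl] := gmax c cwe cwd.
by exists (k * l); rewrite -mulrA -gl gE mulrA -k1 mul1r.
Qed.

(** If [h] divides both cofactors, [h * c] is a common divisor of [a] and [b], so it divides the gcd
    [c]; cancelling [c] leaves [h] dividing 1. *)
Lemma gcd_cofactors {A : idomainType} (a b : A) :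
  GCD_domain A -> a != 0 -> b != 0 ->
  exists c d e, [/\ c != 0, a = c * e, b = c * d & is_gcd e d 1].
Proof.
move=> gcdA a0 b0; have [c [[e aE] [d bE] cmax]] := gcdA a b a0 b0.
have c0 : c != 0 by apply: contraNneq a0 => c0; rewrite aE c0 mulr0.
exists c, d, e; split; rewrite // 1?mulrC //.
split; [by exists e; rewrite mulr1 | by exists d; rewrite mulr1 |].
move=> h [e' eE] [d' dE].
have [|| k E] := cmax (h * c).
- by exists e'; rewrite aE eE mulrA.
- by exists d'; rewrite bE dE mulrA.
by exists k; apply: (mulIf c0); rewrite mul1r -mulrA.
Qed.

Section TorsionFree.
Context {A : idomainType} {M : lmodType A}.
Hypothesis tfM : torsion_free M.

Lemma torsion_free_scalerI (a : A) : a != 0 -> injective ( *:%R a : M -> M).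
Proof.
move=> a0 x y E; have /tfM[/eqP|/eqP] : a *: (x - y) = 0.
- by rewrite scalerBr E subrr.
- by rewrite (negPf a0).
- by rewrite subr_eq0 => /eqP.
Qed.

Variable P : prime_idealr A.

Lemma denom_neq0 (s : denom P) : dval s != 0.
Proof. by apply: contraNneq (denomP s) => ->; rewrite idealr0. Qed.

(** Torsion-freeness cancels the auxiliary multiplier [u] in the equality of fractions. *)
Lemma loc_frac_eqP (x y : M) (s t : denom P) :
  loc_frac x s = loc_frac y t <-> dval t *: x = dval s *: y.
Proof.
split=> [/loc_frac_eq[u]|E]; first exact/torsion_free_scalerI/denom_neq0.
by apply/loc_frac_eq; exists (denom1 P); rewrite E.
Qed.

Lemma loc_frac_eq0 (x : M) (s : denom P) : loc_frac x s = 0 <-> x = 0.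
Proof.
rewrite -[0 in X in X <-> _]/(loc_frac 0 (denom1 P)) loc_frac_eqP /=.
by rewrite scale1r scaler0.
Qed.

Lemma loc_ring_frac_eq0 (a : A) (s : denom P) : loc_ring_frac a s = 0 <-> a = 0.
Proof.
rewrite -[0 in X in X <-> _]/(loc_ring_frac 0 (denom1 P)) loc_ring_frac_eq /=.
by rewrite mul1r mulr0.
Qed.

Lemma localization_torsion_free :
  torsion_free (localization P M : lmodType (local_ring P)).
Proof.
move=> p q; have [a [s ->]] := loc_ring_fracP p.
have [x [t ->]] := loc_fracP q.
by rewrite loc_fracZ !(loc_frac_eq0, loc_ring_frac_eq0) => /tfM.
Qed.

End TorsionFree.

Lemma PS_module_localization {A : idomainType} {M : lmodType A}
    (P : prime_idealr A) :
  PS_module M -> PS_module (localization P M : lmodType (local_ring P)).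
Proof.
move=> [tfM refM]; split; first exact: localization_torsion_free.
move=> p q m n; have [a [s ->]] := loc_ring_fracP p.
have [b [s' ->]] := loc_ring_fracP q.
have [x [t ->]] := loc_fracP m; have [y [t' ->]] := loc_fracP n.
move=> a0 b0 x0 y0; rewrite !loc_fracZ => /(loc_frac_eqP tfM) /=.
rewrite !scalerA => E.
have {}a0 : a != 0 by apply: contraNneq a0 => /(loc_ring_frac_eq0 P a s) ->.
have {}b0 : b != 0 by apply: contraNneq b0 => /(loc_ring_frac_eq0 P b s') ->.
have {}x0 : x != 0 by apply: contraNneq x0 => /(loc_frac_eq0 tfM P x t) ->.
have {}y0 : y != 0 by apply: contraNneq y0 => /(loc_frac_eq0 tfM P y t') ->.
(* The refined equality is the cross-multiplied one, with coefficients [s' t' a] and [s t b].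
   Dividing the factors by [s s'], [t] and [t'] restores [a / s], [b / s'], [x / t] and [y / t']. *)
have [|| c [d [e [z [aE bE -> ->]]]]] := refM _ _ x y _ _ x0 y0 E.
- by rewrite !mulf_neq0 ?denom_neq0.
- by rewrite !mulf_neq0 ?denom_neq0.
exists (loc_ring_frac c (denomM s s')), (loc_ring_frac d t),
  (loc_ring_frac e t'), (loc_frac z (denom1 P)).
rewrite !loc_ring_fracM !loc_fracZ; split.
- by apply/loc_ring_frac_eq; rewrite /= -aE; ring.
- by apply/loc_ring_frac_eq; rewrite /= -bE; ring.
- by apply/(loc_frac_eqP tfM); rewrite /= mulr1.
- by apply/(loc_frac_eqP tfM); rewrite /= mulr1.
Qed.

Lemma coprime_refinement_outside_prime {A : idomainType} {M : lmodType A}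
    (P : prime_idealr A) (d e : A) (x y : M) :
  GCD_domain A -> torsion_free M ->
  PS_module (localization P M : lmodType (local_ring P)) ->
  d != 0 -> e != 0 -> x != 0 -> y != 0 -> is_gcd e d 1 ->
  e *: x = d *: y -> exists2 r, r \notin P & exists z, r *: x = d *: z.
Proof.
move=> gcdA tfM [_ refP] d0 e0 x0 y0 ed1 E; pose u := denom1 P.
have [||||| C [D [E' [Z []]]]] := refP (loc_ring_frac e u) (loc_ring_frac d u)
    (loc_frac x u) (loc_frac y u).
- by apply/eqP => /loc_ring_frac_eq0/eqP; apply/negP.
- by apply/eqP => /loc_ring_frac_eq0/eqP; apply/negP.
- by apply/eqP => /(loc_frac_eq0 tfM)/eqP; apply/negP.
- by apply/eqP => /(loc_frac_eq0 tfM)/eqP; apply/negP.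
- by rewrite !loc_fracZ E.
have [c [s ->]] := loc_ring_fracP C; have [d' [s2 ->]] := loc_ring_fracP D.
have [e' [s1 ->]] := loc_ring_fracP E'; have [z [t ->]] := loc_fracP Z.
rewrite !loc_ring_fracM !loc_fracZ => /loc_ring_frac_eq /= eE.
move=> /loc_ring_frac_eq /= dE /(loc_frac_eqP tfM) /= xE _.
rewrite !mul1r scale1r in eE dE xE.
(* Multiplying by [w = s s1 s2] clears both denominators: [w e = s2 c e'] and [w d = s1 c d']. *)
pose w := denomM (denomM s s1) s2.
have [k wE] : divides c (dval w).
  apply: (gcd1_dvd_mul c d e (dval w)) => //; first exact: denom_neq0.
    exists (dval s2 * e').
    transitivity (dval s2 * (c * e')); last by ring.
    by rewrite -eE /=; ring.
  exists (dval s1 * d').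
  transitivity (dval s1 * (c * d')); last by ring.
  by rewrite -dE /=; ring.
have cP : c \notin P.
  by apply: contra (denomP w) => cP; rewrite wE prime_idealrM cP orbT.
(* From [s2 t x = d' z] and [c d' = s s2 d] follows [c s2 t x = d (s s2 z)]. *)
exists (c * (dval s2 * dval t)).
  by rewrite !prime_idealrM !negb_or cP !denomP.
exists ((dval s * dval s2) *: z).
by rewrite -[LHS]scalerA xE !scalerA -dE; congr (_ *: _); ring.
Qed.

Theorem proposition2p15 (A : idomainType) (M : lmodType A) :
  GCD_domain A -> torsion_free M ->
  (PS_module M <->
   forall (P : {pred A}) (mP : maximal_ideal P),
     PS_module (localization (prime_of_maximal mP) M
                  : lmodType (local_ring (prime_of_maximal mP)))).
Proof.
move=> gcdA tfM; split=> [psM P mP|psMP]; first exact: PS_module_localization.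
split=> // a b x y a0 b0 x0 y0 E.
have [c [d [e [c0 aE bE ed1]]]] := gcd_cofactors a b gcdA a0 b0.
have e0 : e != 0 by apply: contraNneq a0 => e0; rewrite aE e0 mulr0.
have d0 : d != 0 by apply: contraNneq b0 => d0; rewrite bE d0 mulr0.
have {}E : e *: x = d *: y.
  by apply: (torsion_free_scalerI tfM c c0); rewrite !scalerA -aE -bE.
(* Then [d y = e x = d e z], and cancelling [d] gives [y = e z]. *)
suff [z xE] : exists z, x = d *: z.
  exists c, d, e, z; split=> //; apply: (torsion_free_scalerI tfM d d0).
  by rewrite -E xE !scalerA mulrC.
pose I : {pred A} := [pred r | `[< exists z, r *: x = d *: z >]].
(* The negated goal [xNd] says that 1 is not in [I], which is the properness required to place [I]
   inside a maximal ideal. *)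
apply: contrapT => xNd.
have [|P mP IP] := maximal_ideal_exists A I.
  split; first by apply/asboolP; exists 0; rewrite scale0r scaler0.
    by apply/asboolP; rewrite scale1r.
  move=> r u v /asboolP[z zE] /asboolP[z' z'E]; apply/asboolP.
  exists (r *: z + z'); rewrite scalerDl -scalerA zE z'E scalerDr !scalerA.
  by rewrite mulrC.
have [r rP rI] := coprime_refinement_outside_prime (prime_of_maximal mP)
  d e x y gcdA tfM (psMP P mP) d0 e0 x0 y0 ed1 E.
by apply: (negP rP); apply: IP; apply/asboolP.
Qed.
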